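(* Let $\mathcal{A}\subseteq\mathbb{R}^k$ be a finite nonempty set with $n=|\mathcal{A}|$, $d$ a metric on $\mathbb{R}^k$, $q\ge1$, $C>0$, $\alpha>0$. If there is no ball $B$ with radius $\sqrt[q]{C}$ that contains more than $(1-\alpha)\cdot n$ points of $\mathcal{A}$, then the empty barycenter $\emptyset$ is an optimal solution to the barycenter problem with empty set $\mathrm{Bar}_{C,\alpha}(\mathcal{A})$.
   Context: A ball with radius $r$ is a set $\{y\in\mathbb{R}^k: d(x,y)\le r\}$ with $x\in\mathbb{R}^k$. $d^q(x,y)=(d(x,y))^q$. Adjoin to $\mathbb{R}^k$ an extra element $\emptyset$ (the ''empty barycenter''). The problem $\mathrm{Bar}_{C,\alpha}(\mathcal{A})$ is to minimize $f_{C,\alpha}(x,\mathcal{A})$ over $x\in\mathbb{R}^k\cup\{\emptyset\}$, where $f_{C,\alpha}(x,\mathcal{A})=\sum_{a\in\mathcal{A}}\min\{d^q(x,a),C\}$ for $x\in\mathbb{R}^k$ and $f_{C,\alpha}(\emptyset,\mathcal{A})=n\cdot\alpha\cdot C$. An optimal solution is a minimizer. *)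

(* Defs.v *)
From HB Require Import structures.
From mathcomp Require Import all_boot all_order all_algebra finmap.
From mathcomp Require Import all_classical all_reals all_analysis.

Set Implicit Arguments.
Unset Strict Implicit.
Unset Printing Implicit Defensive.

Import Order.TTheory GRing.Theory Num.Theory.

Local Open Scope classical_set_scope.
Local Open Scope ring_scope.

(* A predicate rather than the bundled metricType: d is an arbitrary metric,
   in general unrelated to the canonical (sup-norm) structure on 'rV[R]_k. *)
Definition is_metric (R : realType) (T : Type) (d : T -> T -> R) : Prop :=
  [/\ forall x y, 0 <= d x y,
      forall x y, d x y = 0 <-> x = y,
      forall x y, d x y = d y x
    & forall x y z, d x z <= d x y + d y z].

Definition ball_of_radius (R : realType) (T : Type) (d : T -> T -> R) (r : R)
    (B : set T) : Prop :=
  exists x, B = [set y | d x y <= r].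

(* None stands for the empty barycenter. *)
Definition bar_cost (R : realType) (k : nat)
    (d : 'rV[R]_k -> 'rV[R]_k -> R) (q C alpha : R)
    (x : option 'rV[R]_k) (A : {fset 'rV[R]_k}) : R :=
  match x with
  | Some x => \sum_(a <- A) Num.min (d x a `^ q) C
  | None => (#|` A|)%:R * alpha * C
  end.

Definition bar_optimal (R : realType) (k : nat)
    (d : 'rV[R]_k -> 'rV[R]_k -> R) (q C alpha : R)
    (A : {fset 'rV[R]_k}) (x : option 'rV[R]_k) : Prop :=
  forall y, bar_cost d q C alpha x A <= bar_cost d q C alpha y A.

(* Main.v *)
(** A point of [A] outside the ball of radius [C `^ q^-1] around [x] costs
    exactly [C], and by assumption at least [alpha * n] of the points are
    outside, so placing the barycenter at [x] costs at least [n * alpha * C]. *)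
Require Import Defs.
From HB Require Import structures.
From mathcomp Require Import all_boot all_order all_algebra finmap.
From mathcomp Require Import all_classical all_reals all_analysis.

Set Implicit Arguments.
Unset Strict Implicit.
Unset Printing Implicit Defensive.

Import Order.TTheory GRing.Theory Num.Theory.

Local Open Scope classical_set_scope.
Local Open Scope fset_scope.
Local Open Scope ring_scope.

Lemma natr_card_fset_sep (R : pzSemiRingType) (T : choiceType) (A : {fset T})
    (P : pred T) :
  (#|` [fset a in A | P a]|)%:R = \sum_(a <- A) (P a)%:R :> R.
Proof.
rewrite card_fset_sum1 natr_sum -big_fset_condE big_mkcond /=.
by apply: eq_bigr => a _; case: (P a).
Qed.

Lemma ler_indicator_min_powR (R : realType) (q C t : R) :
  0 < q -> 0 < C -> 0 <= t ->
  (1 - (t <= C `^ q^-1)%R%:R) * C <= Num.min (t `^ q) C.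
Proof.
move=> q0 C0 t0; rewrite le_min.
case: (leP t (C `^ q^-1)) => [_|ltr].
  by rewrite subrr mul0r powR_ge0 ltW.
rewrite subr0 mul1r lexx andbT.
have <- : (C `^ q^-1) `^ q = C.
  by rewrite -powRrM mulVf ?gt_eqF // powRr1 // ltW.
by apply: ge0_ler_powR; rewrite ?nnegrE ?powR_ge0 // ltW.
Qed.

Theorem lemma19 (R : realType) (k : nat) (A : {fset 'rV[R]_k})
    (d : 'rV[R]_k -> 'rV[R]_k -> R) (q C alpha : R) :
  A != fset0 -> is_metric d -> 1 <= q -> 0 < C -> 0 < alpha ->
  ~ (exists B : set 'rV[R]_k, ball_of_radius d (C `^ q^-1) B /\
       (1 - alpha) * (#|` A|)%:R < (#|` [fset a in A | a \in B]|)%:R) ->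
  bar_optimal d q C alpha A None.
Proof.
move=> _ [d_ge0 _ _ _] q1 C0 _ noball [x|] //=.
have q0 : 0 < q by apply: lt_le_trans q1.
set r := C `^ q^-1 in noball.
have few : \sum_(a <- A) (d x a <= r)%R%:R <= (1 - alpha) * (#|` A|)%:R.
  rewrite leNgt; apply/negP => many; apply: noball.
  exists [set y | d x y <= r]; split; first by exists x.
  rewrite natr_card_fset_sep; apply: (lt_le_trans many).
  (* A termwise inequality between the two indicators suffices, so only one direction of the passage
     to classical membership is needed. *)
  apply: ler_sum => a _; case: (boolP (d x a <= r)) => // dxa.
  by rewrite mem_set.
(* The intermediate sum is [C] times the number of points outside the ball around [x]. *)
apply: (@le_trans _ _ (\sum_(a <- A) (1 - (d x a <= r)%R%:R) * C)); last first.
  by apply: ler_sum => a _; apply: ler_indicator_min_powR.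
rewrite -mulr_suml ler_pM2r // sumrB.
have -> : \sum_(a <- A) 1 = (#|` A|)%:R :> R.
  by rewrite big_const_seq count_predT iter_addr_0.
(* With [C] cancelled, what remains is [few] rearranged. *)
by rewrite lerBrDr -lerBrDl mulrC -[X in _ <= X - _]mul1r -mulrBl.
Qed.
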